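(* Assume that for every projective toric surface $\mathbb P'$ (with $r$ rays in its fan, lattice ideal $I_{\mathbb P'}\subseteq k[x_1,\dots,x_r]$, and $e'$ a point of its big torus) the following two conditions are equivalent: (1) the Cox ring of $\mathrm{Bl}_{e'}\mathbb P'$ is generated in multiplicity $1$; (2) for any three (distinct) indices $i,j,k$, $I_{\mathbb P'}\not\subseteq\langle x_i,x_j,x_k\rangle^2$. Let $\mathbb P$ be a minimal toric surface of Picard rank two and $e$ a point of its big torus. Then the Cox ring of $\mathrm{Bl}_e\mathbb P$ is generated in multiplicity $1$.
   Context: The ground field $k$ is algebraically closed of characteristic $0$. A (normal projective) toric surface is minimal if it contains no curve with negative self-intersection. For a projective toric surface $\mathbb P$ with fan $\Sigma$ let $\rho_1,\dots,\rho_r\in N\cong\mathbb Z^2$ be the primitive generators of the rays, $M=\mathrm{Hom}(N,\mathbb Z)$, and let $L\subseteq\mathbb Z^r$ be the image of $M\to\mathbb Z^r$, $u\mapsto(\langle u,\rho_i\rangle)_i$. The lattice ideal of $\mathbb P$ is $I_{\mathbb P}=\langle x^{m^+}-x^{m^-} : m\in L\rangle$, where $m^+=(\max(m_i,0))_i$, $m^-=(-\min(m_i,0))_i$. The Cox ring of $\mathbb P$ is $R=k[x_1,\dots,x_r]$, graded by $\mathrm{Cl}(\mathbb P)$. The Cox ring of $\mathrm{Bl}_e\mathbb P$ is identified with the $\mathrm{Cl}(\mathbb P)\oplus\mathbb Z$-graded subalgebra of $R[t,t^{-1}]$ spanned by the elements $ft^{-i}$, $i\in\mathbb Z$, with $f\in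 R$ homogeneous such that the divisor of $f$ on $\mathbb P$ has multiplicity at least $i$ at $e$ (so $t$ corresponds to the exceptional divisor). It is generated in multiplicity $m$ if it is generated by $t$ together with homogeneous elements of the form $ft^{-i}$ with $f\in R$ and $0\le i\le m$. *)

(* Defs.v *)
From HB Require Import structures.
From mathcomp Require Import all_boot all_order all_algebra.
From mathcomp Require Import fraction mpoly.

Set Implicit Arguments.
Unset Strict Implicit.
Unset Printing Implicit Defensive.

Import Order.TTheory GRing.Theory Num.Theory.
Local Open Scope ring_scope.

Local Notation "x %:F" := (tofrac x).

(** * Projective toric surfaces

    N = M = Z^2, as row vectors, in duality by the standard pairing. *)

Definition pairing (u v : 'rV[int]_2) : int := \sum_j u 0 j * v 0 j.

Definition det2 (v w : 'rV[int]_2) : int :=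
  v 0 0 * w 0 1 - v 0 1 * w 0 0.

Definition primitive (v : 'rV[int]_2) : bool := coprimez (v 0 0) (v 0 1).

(** [adjacent rho i j]: the rays of [rho i] and [rho j], in counterclockwise
    order, make an angle less than pi, and no [rho l] lies strictly between
    them.  When the [rho i] are distinct and primitive, the cones spanned by the
    adjacent pairs always meet along common faces. *)
Definition adjacent (r : nat) (rho : 'I_r -> 'rV[int]_2) (i j : 'I_r) : bool :=
  (0 < det2 (rho i) (rho j)) &&
  [forall l, ~~ ((0 < det2 (rho i) (rho l)) && (0 < det2 (rho l) (rho j)))].

(** A complete fan in the plane is determined by its rays, its maximal cones
    being those spanned by adjacent rays; and a complete toric surface is
    automatically projective.  So a projective toric surface is given by the
    primitive generators of its rays, subject to the condition that the
    maximal cones cover the plane (it suffices to cover its rational points). *)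
Record toric_surface := ToricSurface {
  nrays : nat;
  ray : 'I_nrays -> 'rV[int]_2;
  ray_primitive : forall i, primitive (ray i);
  ray_inj : injective ray;
  ray_complete : forall v : 'rV[rat]_2,
    exists i j (a b : rat), [/\ adjacent ray i j, 0 <= a, 0 <= b &
      v = a *: map_mx intr (ray i) + b *: map_mx intr (ray j)]
}.

(** ** Torus invariant divisors: elements of Z^r *)

Section Divisors.

Variable P : toric_surface.
Local Notation r := (nrays P).
Local Notation div := 'rV[int]_r.

Definition inL (m : div) : Prop :=
  exists u : 'rV[int]_2, m = \row_i pairing u (ray i).

(** On the affine chart of each maximal cone, the divisor is that of a
    character. *)
Definition cartier (D : div) : Prop :=
  forall i j, adjacent (@ray P) i j ->
    exists u : 'rV[int]_2, pairing u (ray i) = D 0 i /\ pairing u (ray j) = D 0 j.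

(** Linear independence over Z of the classes in Cl(P) = Z^r / L. *)
Definition class_free (n : nat) (D : 'I_n -> div) : Prop :=
  forall c : 'I_n -> int, inL (\sum_i c i *: D i) -> forall i, c i = 0.

(** The rank of Pic(P), the group of Cartier divisors modulo L. *)
Definition has_picard_rank (n : nat) : Prop :=
  (exists D : 'I_n -> div, (forall i, cartier (D i)) /\ class_free D) /\
  (forall (n' : nat) (D : 'I_n' -> div),
     (forall i, cartier (D i)) -> class_free D -> (n' <= n)%N).

(** Intersection numbers of the boundary curves.  For adjacent i, j,
    D_i.D_j is 1 / mult(cone(rho_i, rho_j)).  For i = j, the value follows from
    (\sum_l <u, rho_l> D_l).D_i = 0 for all u in M, given the relation
      det(p,i)^-1 rho_p + det(i,n)^-1 rho_n
        = det(p,n) / (det(p,i) det(i,n)) rho_i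
    between rho_i and its two neighbours rho_p, rho_n; the sum below has exactly
    one term. *)
Definition inter_ray (i j : 'I_r) : rat :=
  let d a b : rat := (det2 (ray a) (ray b))%:~R in
  if i == j then
    - \sum_(p | adjacent (@ray P) p i) \sum_(n | adjacent (@ray P) i n)
        d p n / (d p i * d i n)
  else if adjacent (@ray P) i j then (d i j)^-1
  else if adjacent (@ray P) j i then (d j i)^-1
  else 0.

Definition inter (D E : div) : rat :=
  \sum_i \sum_j (D 0 i)%:~R * (E 0 j)%:~R * inter_ray i j.

End Divisors.

(** * Ideals and subalgebras given by generators *)

Definition ideal_gen (R : comNzRingType) (S : R -> Prop) (f : R) : Prop :=
  exists s : seq (R * R),
    (forall p, p \in s -> S p.2) /\ f = \sum_(p <- s) p.1 * p.2.

Definition ideal_mul (R : comNzRingType) (I J : R -> Prop) : R -> Prop :=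
  ideal_gen (fun f => exists g h, [/\ I g, J h & f = g * h]).

(** The subalgebra generated by [S]; [iota] is the structure map. *)
Inductive subalg_gen (k A : comNzRingType) (iota : k -> A) (S : A -> Prop) :
  A -> Prop :=
| SubalgGen z of S z : subalg_gen iota S z
| SubalgScalar c : subalg_gen iota S (iota c)
| SubalgAdd z w of subalg_gen iota S z & subalg_gen iota S w :
    subalg_gen iota S (z + w)
| SubalgMul z w of subalg_gen iota S z & subalg_gen iota S w :
    subalg_gen iota S (z * w).

(** * The Cox ring of a toric surface and of its blow-up *)

Section Cox.

Variables (k : closedFieldType) (P : toric_surface).
Local Notation r := (nrays P).
Local Notation R := {mpoly k[r]}.

Definition expo (m : 'X_{1..r}) : 'rV[int]_r := \row_i (m i)%:Z.

(** Homogeneity for the grading of R by Cl(P) = Z^r / L. *)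
Definition cl_homog (f : R) : Prop :=
  forall m m', m \in msupp f -> m' \in msupp f -> inL (expo m - expo m').

(** Effective divisors on P are the divisors of the nonzero homogeneous elements
    of R, which are unique up to scalars; (irreducible) curves are those which
    are nonzero and not a sum of two nonzero effective divisors.  If Cl(P) has
    torsion, [f] need not be irreducible in R. *)
Definition curve (f : R) : Prop :=
  [/\ f != 0, cl_homog f, f \isn't a GRing.unit &
    forall g h, cl_homog g -> cl_homog h -> f = g * h ->
      (g \is a GRing.unit) || (h \is a GRing.unit)].

(** The class of the divisor of [f] is that of the exponent of any of its
    monomials. *)
Definition minimal_surface : Prop :=
  ~ exists f m, [/\ curve f, m \in msupp f & inter (expo m) (expo m) < 0].

Definition mpos (m : 'rV[int]_r) : 'X_{1..r} :=
  [multinom absz (Num.max (m 0 i) 0)%R | i < r].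
Definition mneg (m : 'rV[int]_r) : 'X_{1..r} :=
  [multinom absz (- Num.min (m 0 i) 0)%R | i < r].

Definition lattice_ideal : R -> Prop :=
  ideal_gen (fun f => exists2 m, inL m & f = 'X_[mpos m] - 'X_[mneg m]).

Definition vars3_ideal (i j l : 'I_r) : R -> Prop :=
  ideal_gen (fun f => [\/ f = 'X_i, f = 'X_j | f = 'X_l]).

Definition vars3_ideal_sq (i j l : 'I_r) : R -> Prop :=
  ideal_mul (vars3_ideal i j l) (vars3_ideal i j l).

(** Points of the big torus: homomorphisms from M to the units of k. *)
Definition torus_point (e : 'I_2 -> k) : Prop := forall j, e j != 0.

(** The pullback of the coordinate y_j of the torus is the Laurent monomial
    \prod_i x_i^(rho_i)_j.  [h] is an equation on the torus of the divisor of [f]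
    if its pullback is [f] up to a Laurent monomial; [h] can be taken
    polynomial, as the y_j are units on the torus. *)
Definition torus_coord (j : 'I_2) : {fraction R} :=
  \prod_i (('X_i : R)%:F ^ ray i 0 j).

Definition torus_equation (f : R) (h : {mpoly k[2]}) : Prop :=
  exists a : 'rV[int]_r,
    f%:F = (\prod_i (('X_i : R)%:F ^ a 0 i))
           * mmap (fun c : k => (c%:MP : R)%:F) torus_coord h.

(** All terms of the Taylor expansion of [h] at [e] have degree at least [i]. *)
Definition mult_poly_ge (e : 'I_2 -> k) (h : {mpoly k[2]}) (i : int) : Prop :=
  forall m, m \in msupp (h \mPo [tuple 'X_j + (e j)%:MP | j < 2]) ->
    i <= (mdeg m)%:Z.

Definition mult_ge (e : 'I_2 -> k) (f : R) (i : int) : Prop :=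
  exists2 h, torus_equation f h & mult_poly_ge e h i.

(** R[t, t^-1] is realised inside the fraction field of R[t]. *)
Local Notation K := {fraction {poly R}}.

Definition cst (f : R) : K := (f%:P)%:F.
Definition tvar : K := ('X : {poly R})%:F.

Definition cox_pair (e : 'I_2 -> k) (f : R) (i : int) : Prop :=
  cl_homog f /\ mult_ge e f i.

Definition cox_blowup (e : 'I_2 -> k) (z : K) : Prop :=
  exists s : seq (R * int),
    (forall p, p \in s -> cox_pair e p.1 p.2) /\
    z = \sum_(p <- s) cst p.1 * tvar ^ (- p.2).

Definition cox_generators (e : 'I_2 -> k) (m : nat) (z : K) : Prop :=
  z = tvar \/
  exists f i, [/\ cox_pair e f i, 0 <= i <= m%:Z & z = cst f * tvar ^ (- i)].

Definition cox_generated_in_mult (e : 'I_2 -> k) (m : nat) : Prop :=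
  forall z, cox_blowup e z <->
    subalg_gen (fun c : k => cst c%:MP) (cox_generators e m) z.

End Cox.

(* Main.v *)
(** On a minimal toric surface D_i^2 >= 0 for every boundary curve D_i, that is,
    det(rho_p, rho_n) <= 0 for the two neighbours rho_p, rho_n of any ray rho_i.
    Picard rank two forces at least four rays, and then the Pluecker relation
    turns these inequalities into rho_n = - rho_p: the rays are a, b, -a, -b.
    Given three indices, let l be the remaining one and x a ray other than the
    l-th one and its opposite.  Choosing u in M with <u, rho_x> = 1 and, up to
    exchanging x with its opposite, <u, rho_l> >= 0, one gets the binomial
    x_x x_l^c - x_x' x_l'^c of the lattice ideal.  Its first monomial has degree
    at most one in the three given variables, so it is not in the square of the
    ideal that they generate. *)

Require Import Defs.
From mathcomp Require Import all_boot all_order all_algebra.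
From mathcomp Require Import fraction mpoly.
From mathcomp Require Import ring lra.
Import Order.TTheory GRing.Theory Num.Theory.
Local Open Scope ring_scope.

Set Implicit Arguments.
Unset Strict Implicit.

(** * Determinants, pairings and primitive vectors in the plane lattice *)

Lemma det2C u v : det2 u v = - det2 v u.
Proof. rewrite /det2; ring. Qed.

Lemma det2Nl u v : det2 (- u) v = - det2 u v.
Proof. rewrite /det2 !mxE; ring. Qed.

Lemma det2Nr u v : det2 u (- v) = - det2 u v.
Proof. rewrite /det2 !mxE; ring. Qed.

Lemma det2_plucker a b c d :
  det2 a b * det2 c d - det2 a c * det2 b d + det2 a d * det2 b c = 0.
Proof. rewrite /det2; ring. Qed.

Lemma pairingE u v : pairing u v = u 0 0 * v 0 0 + u 0 1 * v 0 1.
Proof.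
by rewrite /pairing !big_ord_recl big_ord0 addr0; congr (_ + u 0 _ * v 0 _);
  apply: val_inj.
Qed.

(** Divided by [det2 u v * det2 u w], the left side is the difference of the cotangents of the
    angles from [u] to [w] and from [u] to [v]. *)
Lemma det2_pairing u v w :
  det2 u v * pairing u w - pairing u v * det2 u w =
  pairing u u * det2 w v.
Proof. rewrite !pairingE /det2; ring. Qed.

Lemma primitive_pairing1 v : primitive v -> exists u, pairing u v = 1.
Proof.
case/coprimezP=> -[a b] /= ab.
exists (\row_j (if j == 0 then a else b)).
by rewrite pairingE !mxE.
Qed.

Lemma eq_rV2 (u v : 'rV[int]_2) : u 0 0 = v 0 0 -> u 0 1 = v 0 1 -> u = v.
Proof.
move=> e0 e1; apply/rowP=> j.
by case: j => -[|[|//]] lt_j; [move: e0 | move: e1];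
  congr (_ = _); congr (_ _ _); apply: val_inj.
Qed.

Lemma det2_eq0 u v : primitive u -> primitive v -> det2 u v = 0 ->
  v = u \/ v = - u.
Proof.
move=> /primitive_pairing1[a au] /primitive_pairing1[b bv] /eqP.
rewrite /det2 subr_eq0 => /eqP uv.
(* A vanishing determinant makes [v] proportional to [u]; pairing with [a] shows that the factor is
   an integer, and pairing with [b] that it is a unit, hence a sign. *)
have vE : v = pairing a v *: u.
  move: au; rewrite !pairingE => au;
    apply: eq_rV2; rewrite !mxE -[LHS]mul1r -au.
    by have := congr1 ( *%R (a 0 1)) uv => /=; lra.
  by have := congr1 ( *%R (a 0 0)) uv => /=; lra.
have : pairing b u * pairing a v = 1.
  rewrite mulrC -bv {2}vE /pairing mulr_sumr; apply: eq_bigr => j _.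
  rewrite mxE; ring.
move=> /intUnitRing.unitzPl.
rewrite qualifE /= => /pred2P[]e; rewrite vE e ?scale1r ?scaleN1r; by [left|right].
Qed.

(** One positive value among [x], [y], [z] would make all three positive, and so the sum. Hence all
    are nonpositive, and every term of the vanishing sum is zero. *)
Lemma cyclic_pos_sum_eq0 (R : realDomainType) (a b c x y z : R) :
  0 < a -> 0 < b -> 0 < c -> a * x + b * y + c * z = 0 ->
  (0 < x -> 0 < y) -> (0 < y -> 0 < z) -> (0 < z -> 0 < x) -> x = 0 /\ y = 0.
Proof.
move=> a0 b0 c0 e xy yz zx; have [x0|x0] := ltP 0 x.
  have y0 := xy x0; have z0 := yz y0.
  have := mulr_gt0 a0 x0; have := mulr_gt0 b0 y0; have := mulr_gt0 c0 z0.
  by move: e; clear=> *; exfalso; lra.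
have z0 : z <= 0 by rewrite leNgt; apply/negP=> /zx; rewrite ltNge x0.
have y0 : y <= 0 by rewrite leNgt; apply/negP=> /yz; rewrite ltNge z0.
have ax := mulr_ge0_le0 (ltW a0) x0; have by' := mulr_ge0_le0 (ltW b0) y0.
have cz := mulr_ge0_le0 (ltW c0) z0.
have /eqP : a * x = 0 by move: e ax by' cz; clear=> *; lra.
have /eqP : b * y = 0 by move: e ax by' cz; clear=> *; lra.
by rewrite !mulf_eq0 (gt_eqF a0) (gt_eqF b0) => /eqP-> /eqP->.
Qed.

(** * Neighbouring rays in a complete fan *)

Section Fan.

Variable P : toric_surface.
Local Notation "''d' ( i , j )" := (det2 (@ray P i) (@ray P j)).
Local Notation adj := (adjacent (@ray P)).

Lemma adjacentP i j :
  reflect (0 < 'd(i, j) /\ forall l, 0 < 'd(i, l) -> 0 < 'd(l, j) -> False)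
          (adj i j).
Proof.
apply: (iffP andP) => -[ij h]; split=> //.
  by move=> l il lj; have /forallP/(_ l) := h; rewrite il lj.
by apply/forallP=> l; apply/negP=> /andP[il lj]; apply: (h l).
Qed.

Lemma det2_ray_eq0 i j : 'd(i, j) = 0 -> j = i \/ ray j = - ray i.
Proof.
by case/(det2_eq0 (@ray_primitive P i) (@ray_primitive P j)) => [/ray_inj|];
  [left|right].
Qed.

Lemma det2_ray_eq0_side w i j : 'd(i, j) = 0 ->
  0 < det2 w (ray i) -> 0 < det2 w (ray j) -> j = i.
Proof.
by case/det2_ray_eq0 => // -> iw; rewrite det2Nr oppr_gt0 ltNge ltW.
Qed.

(** If two rays followed [i], the one reached first would lie strictly between [i] and the other. *)
Lemma adjacent_inj i j j' : adj i j -> adj i j' -> j = j'.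
Proof.
move=> /adjacentP[ij hj] /adjacentP[ij' hj'].
case: (ltgtP 'd(j, j') 0) => h.
- by case: (hj j'); rewrite // det2C oppr_gt0.
- by case: (hj' j).
- exact/esym/(det2_ray_eq0_side h ij ij').
Qed.

Lemma adjacent_injl i j j' : adj j i -> adj j' i -> j = j'.
Proof.
move=> /adjacentP[ij hj] /adjacentP[ij' hj'].
case: (ltgtP 'd(j, j') 0) => h.
- by case: (hj' j); rewrite // det2C oppr_gt0.
- by case: (hj j').
- by case/det2_ray_eq0: h => // e; move: ij'; rewrite e det2Nl oppr_gt0 ltNge ltW.
Qed.

Lemma ray_sqnorm_gt0 (i : 'I_(nrays P)) : 0 < pairing (ray i) (ray i).
Proof.
rewrite pairingE -!expr2 lt_def addr_ge0 ?sqr_ge0 // andbT.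
rewrite paddr_eq0 ?sqr_ge0 // !sqrf_eq0; apply/negP=> /andP[/eqP e0 /eqP e1].
by have := ray_primitive i; rewrite /primitive e0 e1.
Qed.

Lemma ray_leftside i : exists j, 0 < 'd(i, j).
Proof.
(* [w] is [ray i] turned counterclockwise by a right angle, so the determinant of [ray i] and [w] is
   positive. A cone containing [w] must then have a generator on the left of [ray i]. *)
pose w : 'rV[rat]_2 :=
  \row_j (if j == 0 then - (ray i 0 1)%:~R else (ray i 0 0)%:~R).
have [p [q [a [b [_ a0 b0 /rowP wE]]]]] := @ray_complete P w.
case: (ltP 0 'd(i, p)) => [ip|ip]; first by exists p.
case: (ltP 0 'd(i, q)) => [iq|iq]; first by exists q.
have := wE 0; have := wE 1; rewrite !mxE /= => w1 w0.
have : (0 : rat) < (pairing (ray i) (ray i))%:~R by rewrite ltr0z ray_sqnorm_gt0.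
have : ('d(i, p)%:~R : rat) <= 0 by rewrite lerz0.
have : ('d(i, q)%:~R : rat) <= 0 by rewrite lerz0.
rewrite pairingE /det2 !rmorphD !rmorphN !rmorphM /= => h1 h2.
have := mulr_ge0_le0 b0 h1; have := mulr_ge0_le0 a0 h2.
nra.
Qed.

(* The ray next to [i] maximises the cotangent of the angle with [ray i] among
   the rays on its left. *)
Lemma adjacent_exists i : exists j, adj i j.
Proof.
have [j0 ij0] := ray_leftside i.
pose cot j : rat := (pairing (ray i) (ray j))%:~R / 'd(i, j)%:~R.
case: (@arg_maxP _ _ _ j0 (fun j => 0 < 'd(i, j)) cot ij0) => j ij hj.
exists j; apply/adjacentP; split=> // l il lj.
have := hj l il; apply/negP; rewrite -ltNge.
rewrite /cot ltr_pdivrMr ?ltr0z // mulrAC ltr_pdivlMr ?ltr0z //.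
rewrite -!intrM ltr_int -subr_gt0 mulrC [X in _ - X]mulrC [X in _ - X]mulrC.
by rewrite det2_pairing mulr_gt0 ?ray_sqnorm_gt0.
Qed.

Lemma pairing_ray_eq0 u :
  (forall i : 'I_(nrays P), pairing u (ray i) = 0) -> u = 0.
Proof.
(* Completeness at the origin supplies two adjacent, hence independent, rays; Cramer's rule then
   applies. *)
move=> u0; have [i [j [_ [_ [/adjacentP[ij _] _ _ _]]]]] := ray_complete P 0.
have := u0 i; have := u0 j; rewrite !pairingE => uj ui.
have cramer t : 'd(i, j) * t = 0 -> t = 0.
  by move/eqP; rewrite mulf_eq0 gt_eqF // => /eqP.
apply: eq_rV2; rewrite !mxE; apply: cramer.
  transitivity (ray j 0 1 * 0 - ray i 0 1 * 0 : int); last by rewrite !mulr0 subrr.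
  rewrite -[in X in X - _]ui -uj /det2; ring.
transitivity (ray i 0 0 * 0 - ray j 0 0 * 0 : int); last by rewrite !mulr0 subrr.
rewrite -[in X in X - _]uj -ui /det2; ring.
Qed.

(** * Picard rank and the number of rays *)

Lemma leq_picard_rank_nrays n (D : 'I_n -> 'rV[int]_(nrays P)) :
  class_free D -> (n.+2 <= nrays P)%N.
Proof.
move=> freeD; rewrite leqNgt; apply/negP=> r_lt.
(* The rows of [B] are the images in L of the two basis characters. With fewer than [n + 2] columns,
   the rows of [A] would satisfy a relation [v]. *)
pose B : 'M[int]_(2, nrays P) := \matrix_(j, i) ray i 0 j.
pose A : 'M[int]_(n + 2, nrays P) := col_mx (\matrix_i D i) B.
have [v vn0 vA] : exists2 v : 'rV[int]_(n + 2), v != 0 & v *m A = 0.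
  (* [A] has fewer columns than rows; padding it with zeros to a square matrix
     makes [det0P] available. *)
  pose A' : 'M[int]_(n + 2) := \matrix_(i, j) oapp (A i) 0 (insub (val j)).
  have r_lt' : (nrays P < n + 2)%N by rewrite addn2.
  have /det0P[v vn0 vA'] : \det A' == 0.
    rewrite -det_tr; apply/det0P; exists (delta_mx 0 (Ordinal r_lt')).
      by apply/eqP=> /matrixP/(_ 0 (Ordinal r_lt'))/eqP; rewrite !mxE !eqxx.
    rewrite -rowE; apply/rowP=> j; rewrite !mxE.
    by rewrite insubF //= ltnn.
  exists v => //; apply/rowP=> j.
  have := congr1 (fun M : 'rV_ _ => M 0 (widen_ord (ltnW r_lt') j)) vA'.
  rewrite !mxE => e; rewrite -[RHS]e; apply: eq_bigr => i _; congr (_ * _).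
  by rewrite [RHS]mxE /= valK.
move: vA; rewrite -[v]hsubmxK mul_row_col => /eqP; rewrite addr_eq0 => /eqP vDB.
(* The relation puts a combination of the [D i] in L, so freeness kills its coefficients; the other
   two entries of [v] form a character vanishing on all rays. *)
have lsub0 : lsubmx v = 0.
  apply/rowP=> i; rewrite [RHS]mxE; move: i.
  apply: freeD; exists (- rsubmx v); apply/rowP=> i.
  have := congr1 (fun M : 'rV_ _ => M 0 i) vDB.
  rewrite -mulNmx !mxE summxE /pairing => e.
  transitivity (\sum_j lsubmx v 0 j * (\matrix_i0 D i0) j i).
    by apply: eq_bigr => j _; rewrite !mxE.
  by rewrite e; apply: eq_bigr => j _; rewrite !mxE.
have rsub0 : rsubmx v = 0.
  apply: pairing_ray_eq0 => i.
  have := congr1 (fun M : 'rV_ _ => M 0 i) vDB.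
  rewrite lsub0 mul0mx !mxE => /esym/eqP; rewrite oppr_eq0 => /eqP e.
  by rewrite -[RHS]e; apply: eq_bigr => j _; rewrite !mxE.
by move: vn0; rewrite -[v]hsubmxK lsub0 rsub0 row_mx0 eqxx.
Qed.

(** * Boundary curves and minimality *)

Lemma curve_var (k : closedFieldType) (i : 'I_(nrays P)) :
  curve ('X_i : {mpoly k[nrays P]}).
Proof.
have sizeX : msize ('X_i : {mpoly k[nrays P]}) = 2 by rewrite msizeX mdeg1.
have X0 : 'X_i != 0 :> {mpoly k[nrays P]} by rewrite -msize_poly_eq0 sizeX.
have unit1 (f : {mpoly k[nrays P]}) : f != 0 -> msize f = 1 -> f \is a GRing.unit.
  move=> f0 /eqP/msize_poly1P[c c0 ->].
  by apply: rmorph_unit; rewrite unitfE.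
split=> //.
- move=> m m'; rewrite msuppX !inE => /eqP-> /eqP->.
  exists 0; rewrite subrr; apply/rowP=> j; rewrite !mxE pairingE !mxE; ring.
- apply/negP=> /unitrP[g [/esym gX _]].
  have g0 : g != 0 by apply: contra_eq_neq gX => ->; rewrite mul0r oner_eq0.
  have := congr1 (fun f : {mpoly k[nrays P]} => msize f) gX.
  rewrite msizeM // sizeX msize1 addn2 /=.
  by move=> [] /esym /eqP; rewrite msize_poly_eq0 (negPf g0).
- move=> g h _ _ Xgh.
  have /norP[g0 h0] : ~~ ((g == 0) || (h == 0)) by rewrite -mulf_eq0 -Xgh.
  have := congr1 (fun f : {mpoly k[nrays P]} => msize f) Xgh.
  rewrite sizeX msizeM //.
  (* [msize] is the total degree plus one, so one of the factors has size 1 and is a nonzero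
     constant. *)
  case sg : (msize g) => [|[|n]].
  + by move/eqP: sg; rewrite msize_poly_eq0 (negPf g0).
  + by rewrite unit1.
  + case sh : (msize h) => [|[|n']].
    * by move/eqP: sh; rewrite msize_poly_eq0 (negPf h0).
    * by rewrite (unit1 h) ?orbT.
    * by rewrite !addSn !addnS.
Qed.

Lemma inter_var i : inter (expo U_(i)) (expo U_(i)) = @inter_ray P i i.
Proof.
rewrite /inter (bigD1 i) //= (bigD1 i) //= !big1 ?addr0.
- by rewrite !mxE mnm1E eqxx !mul1r.
- by move=> j ji; apply: big1 => l _; rewrite !mxE mnm1E eq_sym (negPf ji) !mul0r.
- by move=> j ji; rewrite !mxE !mnm1E [i == j]eq_sym (negPf ji) mulr0 mul0r.
Qed.

Lemma minimal_det (k : closedFieldType) p i n :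
  minimal_surface k P -> adj p i -> adj i n -> 'd(p, n) <= 0.
Proof.
move=> minP pi i_n; rewrite leNgt; apply/negP=> pn; apply: minP.
exists ('X_i : {mpoly k[nrays P]}), U_(i)%MM; split.
- exact: curve_var.
- by rewrite msuppX inE.
(* Neighbours being unique, the double sum reduces to the term of [p] and [n], which has the sign of
   ['d(p, n)]. *)
rewrite inter_var /inter_ray eqxx oppr_lt0 (big_pred1 p); last first.
  by move=> q; apply/idP/eqP => [qi|->//]; apply: adjacent_injl pi.
rewrite (big_pred1 n); last first.
  by move=> q; apply/idP/eqP => [iq|->//]; apply: adjacent_inj i_n.
have [dpi _] := adjacentP _ _ pi; have [din _] := adjacentP _ _ i_n.
by rewrite divr_gt0 ?mulr_gt0 ?ltr0z.
Qed.

(** * Fans with at least four rays and no negative boundary curve *)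

Lemma ray_notin (s : seq 'I_(nrays P)) :
  (size s < nrays P)%N -> exists q, q \notin s.
Proof.
move=> s_lt; apply/existsP; rewrite -negb_forall; apply/negP=> /forallP h.
have := card_size s; rewrite (eq_card (B := predT)) => [|q]; last by rewrite h.
by rewrite card_ord leqNgt s_lt.
Qed.

Lemma adjacent_left i j q : adj i j -> q != j -> 0 < 'd(i, q) -> 0 < 'd(j, q).
Proof.
move=> /adjacentP[ij hij] qj iq; case: (ltgtP 'd(j, q) 0) => // h.
- by case: (hij q); rewrite // det2C oppr_gt0.
- by move: qj; rewrite (det2_ray_eq0_side h ij iq) eqxx.
Qed.

(** The Pluecker relation combines the determinants of [i], [j], [k] with [q] to zero with positive
    coefficients, and [adjacent_left] passes positivity round the cycle. A further ray [q] would
    thus be collinear with both [ray i] and [ray j]. *)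
Lemma adjacent_triangle i j k q :
  adj i j -> adj j k -> adj k i -> q \in [:: i; j; k].
Proof.
move=> ij jk ki; apply/negPn; rewrite !inE !negb_or; apply/and3P=> -[qi qj qk].
have [dij _] := adjacentP _ _ ij; have [djk _] := adjacentP _ _ jk.
have [dki _] := adjacentP _ _ ki.
have hij := adjacent_left ij qj; have hjk := adjacent_left jk qk.
have hki := adjacent_left ki qi.
have [|iq0 jq0] := cyclic_pos_sum_eq0 djk dki dij _ hij hjk hki.
  have := det2_plucker (ray i) (ray j) (ray k) (ray q).
  by rewrite (det2C (ray i) (ray k)) => <-; ring.
case/det2_ray_eq0: iq0 => [qi'|qi']; first by move: qi; rewrite qi' eqxx.
by move: jq0 dij; rewrite qi' det2Nr -det2C => ->; rewrite ltxx.
Qed.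

Lemma adjacent2_opposite i j k :
  (forall p i n, adj p i -> adj i n -> 'd(p, n) <= 0) -> (3 < nrays P)%N ->
  adj i j -> adj j k -> ray k = - ray i.
Proof.
move=> nonneg rays4 ij jk.
have [dij _] := adjacentP _ _ ij; have [djk _] := adjacentP _ _ jk.
case: (ltgtP 'd(i, k) 0) (nonneg _ _ _ ij jk) => // ik _; last first.
  by case/det2_ray_eq0: ik djk => // ->; rewrite det2C oppr_gt0 ltNge ltW.
(* The angle from [ray i] to [ray k] now exceeds pi; the next ray [l] comes before [i], after it, or
   equals it. *)
have ki : 0 < 'd(k, i) by rewrite det2C oppr_gt0.
have [l kl] := adjacent_exists k; have [dkl hkl] := adjacentP _ _ kl.
case: (ltgtP 'd(i, l) 0) => il.
- have [m lm] := adjacent_exists l; have [dlm hlm] := adjacentP _ _ lm.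
  have li : 0 < 'd(l, i) by rewrite det2C oppr_gt0.
  have km := nonneg _ _ _ kl lm.
  have im : 'd(i, m) <= 0 by rewrite leNgt; apply/negP/hlm.
  (* In this relation [- 'd(k, i) * 'd(l, m)] is negative and the other two terms are
     nonpositive. *)
  have := det2_plucker (ray k) (ray l) (ray i) (ray m).
  have := mulr_ge0_le0 (ltW dkl) im; have := mulr_gt0 ki dlm.
  by have := mulr_le0_ge0 km (ltW li); clear=> *; exfalso; lra.
- by case: (hkl i).
- have li := det2_ray_eq0_side il ki dkl; rewrite li in kl.
  have [q] := @ray_notin [:: i; j; k] rays4.
  by rewrite (adjacent_triangle q ij jk kl).
Qed.

Lemma opposite_pairs (l : 'I_(nrays P)) :
  (forall p i n, adj p i -> adj i n -> 'd(p, n) <= 0) -> (3 < nrays P)%N ->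
  exists p l' p',
    [/\ ray l' = - ray l, ray p' = - ray p & forall q, q \in [:: l; p; l'; p']].
Proof.
move=> nonneg rays4; have opp i j k := @adjacent2_opposite i j k nonneg rays4.
have [p lp] := adjacent_exists l; have [l' pl'] := adjacent_exists p.
have [p' lp'] := adjacent_exists l'; have [l2 pl2] := adjacent_exists p'.
have el' := opp _ _ _ lp pl'; have ep' := opp _ _ _ pl' lp'.
have l2E : l2 = l.
  by apply/ray_inj; rewrite (opp _ _ _ lp' pl2) el' opprK.
rewrite {}l2E in pl2; exists p, l', p'; split=> // q.
(* A fifth ray on the left of [l] would also be on the left of [p], then of [l'], hence on the right
   of [l]; the other side is excluded likewise through [p']. *)
apply/negPn; rewrite !inE !negb_or; apply/and4P=> -[ql qp ql' qp'].
have := adjacent_left lp qp; have := adjacent_left pl' ql'.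
have := adjacent_left lp' qp'; have := adjacent_left pl2 ql.
rewrite el' ep' !det2Nl !oppr_gt0.
case: (ltgtP 'd(l, q) 0) => lq.
- by move=> h2 /(_ isT) /h2.
- by move=> _ _ h2 /(_ isT) /h2.
- case/det2_ray_eq0: lq => [e|]; first by move: ql; rewrite e eqxx.
  by rewrite -el' => /ray_inj e; move: ql'; rewrite e eqxx.
Qed.

End Fan.

(** * Lattice binomials outside the square of an ideal of three variables *)

Lemma ideal_gen_msupp_weight (K : idomainType) n (w : 'X_{1..n} -> nat) d
    (S : {mpoly K[n]} -> Prop) :
  {morph w : m m' / (m + m')%MM >-> (m + m')%N} ->
  (forall f, S f -> forall m, m \in msupp f -> (d <= w m)%N) ->
  forall f, ideal_gen S f -> forall m, m \in msupp f -> (d <= w m)%N.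
Proof.
move=> wD hS f [s [sS ->]] m /msupp_sum_le /flatten_mapP[p].
(* A monomial of a product with a generator is a multiple of one of the generator's monomials, and
   multiplication cannot lower an additive weight. *)
rewrite filter_predT => ps /msuppM_le /allpairsP[[m1 m2] /= [_ m2p ->]].
by rewrite wD (leq_trans (hS _ (sS _ ps) _ m2p)) ?leq_addl.
Qed.

Lemma vars3_ideal_sq_msupp (k : closedFieldType) (P : toric_surface)
    (a b c : 'I_(nrays P)) (f : {mpoly k[nrays P]}) m :
  vars3_ideal_sq a b c f -> m \in msupp f -> (2 <= m a + m b + m c)%N.
Proof.
pose w (m : 'X_{1..nrays P}) := (m a + m b + m c)%N.
have wD : {morph w : m m' / (m + m')%MM >-> (m + m')%N}.
  by move=> x y; rewrite /w !mnmDE !addnA; ring.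
have h1 g : vars3_ideal a b c g -> forall m, m \in msupp g -> (1 <= w m)%N.
  apply: ideal_gen_msupp_weight => // _ [] -> x; rewrite msuppX inE => /eqP->;
    by rewrite /w !mnmE eqxx ?addn1 ?addnS.
move=> sqf; apply: (ideal_gen_msupp_weight wD _ sqf) => _ [g [h [/h1 hg /h1 hh ->]]].
move=> x /msuppM_le /allpairsP[[x1 x2] /= [/hg w1 /hh w2 ->]].
by rewrite wD (leq_add w1 w2).
Qed.

Lemma lattice_ideal_not_sub (k : closedFieldType) (P : toric_surface)
    (a b c l x : 'I_(nrays P)) u :
    a != b -> a != c -> b != c -> l \notin [:: a; b; c] ->
    pairing u (ray x) = 1 ->
    (forall q, q != l -> q != x -> pairing u (ray q) <= 0) ->
  ~ (forall f : {mpoly k[nrays P]}, lattice_ideal f -> vars3_ideal_sq a b c f).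
Proof.
move=> ab ac bc; rewrite !inE !negb_or => /and3P[la lb lc] ux uq.
pose m : 'rV[int]_(nrays P) := \row_i pairing u (ray i).
pose f : {mpoly k[nrays P]} := 'X_[mpos m] - 'X_[mneg m].
have Lf : lattice_ideal f.
  exists [:: (1, f)]; split; last by rewrite big_seq1 mul1r.
  by move=> _ /[!inE] /eqP-> /=; exists m => //; exists u.
move=> /(_ f Lf) /vars3_ideal_sq_msupp h.
have /h : mpos m \in msupp f.
  rewrite mcoeff_msupp mcoeffB !mcoeffX eqxx.
  (* The exponents at [x] are 0 and 1, so the two monomials do not cancel. *)
  suff /negPf-> : mneg m != mpos m by rewrite subr0 oner_eq0.
  by apply/eqP=> /mnmP/(_ x); rewrite !mnmE !mxE ux.
apply/negP; rewrite -ltnNge.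
have mE q : l != q -> (mpos m q <= (q == x))%N.
  rewrite eq_sym mnmE mxE => ql; case: eqVneq => [->|qx]; first by rewrite ux.
  by rewrite max_r ?uq.
rewrite (leq_ltn_trans (leq_add (leq_add (mE a la) (mE b lb)) (mE c lc))) //.
(* At most one of the distinct indices [a], [b], [c] is [x], so the degree in these variables is at
   most one. *)
case: (eqVneq a x) ab ac => [->|_ _ _].
  by rewrite ![x == _]eq_sym => /negPf-> /negPf->.
by case: (eqVneq b x) bc => [->|_ _]; [rewrite eq_sym => /negPf->|case: (c == x)].
Qed.

Lemma exists_unit_pairing (P : toric_surface) (l p l' p' : 'I_(nrays P)) :
  ray l' = - ray l -> ray p' = - ray p -> (forall q, q \in [:: l; p; l'; p']) ->
  exists x u, pairing u (ray x) = 1 /\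
    (forall q, q != l -> q != x -> pairing u (ray q) <= 0).
Proof.
move=> el' ep' rays; have [u up] := primitive_pairing1 (ray_primitive p).
have pairingNr v w : pairing v (- w) = - pairing v w.
  by rewrite !pairingE !mxE; ring.
have pairingNl v w : pairing (- v) w = - pairing v w.
  by rewrite !pairingE !mxE; ring.
have [ul|ul] := leP 0 (pairing u (ray l)).
  exists p, u; split=> // q; have := rays q; rewrite !inE => /or4P[]/eqP->;
  by rewrite ?eqxx // ?el' ?ep' pairingNr ?up // oppr_le0.
(* When [u] is negative on [ray l], its opposite is 1 on [ray p'] and negative on [ray l'] and
   [ray p]. *)
exists p', (- u); split; first by rewrite pairingNl ep' pairingNr opprK.
move=> q; have := rays q; rewrite !inE => /or4P[]/eqP->; rewrite ?eqxx // ?el';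
by rewrite pairingNl ?pairingNr ?up // ?opprK ltW.
Qed.

Theorem corollary4p10 (k : closedFieldType) (char0 : [pchar k] =i pred0)
  (multiplicity_one_criterion :
     forall (P' : toric_surface) (e' : 'I_2 -> k), torus_point e' ->
       (cox_generated_in_mult P' e' 1 <->
        forall i j l : 'I_(nrays P'), i != j -> i != l -> j != l ->
          ~ (forall f : {mpoly k[nrays P']},
               lattice_ideal f -> vars3_ideal_sq i j l f)))
  (P : toric_surface) (e : 'I_2 -> k) (e_torus : torus_point e)
  (P_minimal : minimal_surface k P) (P_rank2 : has_picard_rank P 2) :
  cox_generated_in_mult P e 1.
Proof.
apply/(multiplicity_one_criterion P e e_torus) => a b c ab ac bc.
have [[D [_ freeD]] _] := P_rank2.
have rays4 : (3 < nrays P)%N := leq_picard_rank_nrays freeD.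
have [l l_notin] := @ray_notin _ [:: a; b; c] rays4.
have [p [l' [p' [el' ep' rays]]]] :=
  opposite_pairs l (fun _ _ _ => minimal_det P_minimal) rays4.
have [x [u [ux uq]]] := exists_unit_pairing el' ep' rays.
exact: lattice_ideal_not_sub ab ac bc l_notin ux uq.
Qed.
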